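(* Suppose that a group $G$ acts geometrically on a CAT(0) space $X$ and $|\partial X|>2$. Then $X$ is hyperbolic if and only if there exists a constant $c>0$ such that $\limsup\{d_{\partial X}(g\alpha,g\beta)\mid g\in G\}>c$ for any $\alpha,\beta\in\partial X$ with $\alpha\neq\beta$.
   Context: A geometric action is an action by isometries which is proper and cocompact. A geodesic space is hyperbolic if there is $\delta>0$ such that every geodesic triangle is $\delta$-slim. $\partial X$ is the visual boundary; a basepoint $x_0\in X$ is fixed, $\xi_{x_0,\alpha}$ is the geodesic ray from $x_0$ to $\alpha\in\partial X$, and $d_{\partial X}(\alpha,\beta)=\sum_{i=1}^\infty\min\{d(\xi_{x_0,\alpha}(i),\xi_{x_0,\beta}(i)),2^{-i}\}$. The limsup is taken as $g$ leaves every finite subset of $G$. *)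

(* Defs.v *)
From Stdlib Require Import Reals List.
From Coquelicot Require Import Coquelicot.
Open Scope R_scope.

Section Defs.
Variable X : Type.
Variable d : X -> X -> R.

Definition is_metric : Prop :=
  (forall x y, d x y = 0 <-> x = y) /\
  (forall x y, d x y = d y x) /\
  (forall x y z, d x z <= d x y + d y z).

Definition geodesic_seg (x y : X) (s : R -> X) : Prop :=
  s 0 = x /\ s (d x y) = y /\
  (forall t u, 0 <= t <= d x y -> 0 <= u <= d x y -> d (s t) (s u) = Rabs (t - u)).

Definition geodesic_space : Prop :=
  forall x y, exists s, geodesic_seg x y s.

Definition dE2 (p q : R * R) : R :=
  sqrt ((fst p - fst q) ^ 2 + (snd p - snd q) ^ 2).

Definition seg_pt (a b : R * R) (L t : R) : R * R :=
  (fst a + (t / L) * (fst b - fst a), snd a + (t / L) * (snd b - snd a)).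

(** CAT(0): geodesic, and the CAT(0) comparison inequality for every pair of
    points of every geodesic triangle.  Two distinct sides of a triangle share a
    vertex x; points of the same side satisfy the inequality with equality. *)
Definition CAT0 : Prop :=
  geodesic_space /\
  forall (x y z : X) (sy sz : R -> X),
    geodesic_seg x y sy -> geodesic_seg x z sz ->
    forall (x' y' z' : R * R),
      dE2 x' y' = d x y -> dE2 x' z' = d x z -> dE2 y' z' = d y z ->
      forall t u, 0 <= t <= d x y -> 0 <= u <= d x z ->
        d (sy t) (sz u) <= dE2 (seg_pt x' y' (d x y) t) (seg_pt x' z' (d x z) u).

Definition on_seg (x y : X) (s : R -> X) (p : X) : Prop :=
  exists t, 0 <= t <= d x y /\ p = s t.

(** Gromov hyperbolic: geodesic, and there is delta > 0 such that every geodesic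
    triangle is delta-slim (by relabelling the triangle, it suffices to ask this
    of the first side). *)
Definition hyperbolic : Prop :=
  geodesic_space /\
  exists delta, 0 < delta /\
    forall (x y z : X) (sxy syz szx : R -> X),
      geodesic_seg x y sxy -> geodesic_seg y z syz -> geodesic_seg z x szx ->
      forall p, on_seg x y sxy p ->
        exists q, (on_seg y z syz q \/ on_seg z x szx q) /\ d p q <= delta.

Definition geodesic_ray (r : R -> X) : Prop :=
  forall t u, 0 <= t -> 0 <= u -> d (r t) (r u) = Rabs (t - u).

Definition ray_from (x0 : X) (r : R -> X) : Prop := geodesic_ray r /\ r 0 = x0.

Definition asymptotic (r s : R -> X) : Prop :=
  exists K, forall t, 0 <= t -> d (r t) (s t) <= K.

Definition boundary_gt2 : Prop :=
  exists r1 r2 r3, geodesic_ray r1 /\ geodesic_ray r2 /\ geodesic_ray r3 /\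
    ~ asymptotic r1 r2 /\ ~ asymptotic r1 r3 /\ ~ asymptotic r2 r3.

(** d_{∂X} computed on the rays from x0 representing two boundary points *)
Definition dbd (ra rb : R -> X) : R :=
  Series (fun n : nat => Rmin (d (ra (INR (S n))) (rb (INR (S n)))) (/ 2 ^ (S n))).

Definition is_open (U : X -> Prop) : Prop :=
  forall x, U x -> exists r, 0 < r /\ forall y, d x y < r -> U y.

Definition compact (K : X -> Prop) : Prop :=
  forall C : (X -> Prop) -> Prop,
    (forall U, C U -> is_open U) ->
    (forall x, K x -> exists U, C U /\ U x) ->
    exists l : list (X -> Prop),
      (forall U, In U l -> C U) /\ (forall x, K x -> exists U, In U l /\ U x).

Section Group.
Variable G : Type.
Variables (mul : G -> G -> G) (one : G) (inv : G -> G).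

Definition is_group : Prop :=
  (forall a b c, mul (mul a b) c = mul a (mul b c)) /\
  (forall a, mul one a = a) /\ (forall a, mul a one = a) /\
  (forall a, mul (inv a) a = one) /\ (forall a, mul a (inv a) = one).

Variable act : G -> X -> X.

Definition isometric_action : Prop :=
  (forall x, act one x = x) /\
  (forall g h x, act (mul g h) x = act g (act h x)) /\
  (forall g x y, d (act g x) (act g y) = d x y).

Definition finite_set (P : G -> Prop) : Prop :=
  exists l : list G, forall g, P g -> In g l.

(** proper action (Bridson–Haefliger I.8.2) *)
Definition proper_action : Prop :=
  forall x, exists r, 0 < r /\
    finite_set (fun g => exists y, d x y < r /\ d x (act g y) < r).

Definition cocompact_action : Prop :=
  exists K, compact K /\ forall x, exists g k, K k /\ x = act g k.

Definition geometric_action : Prop :=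
  isometric_action /\ proper_action /\ cocompact_action.

(** limsup_{g -> infinity} f(g) > c, where "f(g) > c'" is given by the
    predicate fgt g c'.  Unfolds inf_F sup_{g not in F} f(g) > c over finite F. *)
Definition limsup_gt (fgt : G -> R -> Prop) (c : R) : Prop :=
  exists c', c < c' /\ forall F : list G, exists g, ~ In g F /\ fgt g c'.

(** d_{∂X}(g alpha, g beta) > c', alpha, beta represented by rays a, b;
    g alpha is represented by the ray from x0 asymptotic to g∘a *)
Definition dbd_translate_gt (x0 : X) (a b : R -> X) (g : G) (c' : R) : Prop :=
  exists ra rb, ray_from x0 ra /\ ray_from x0 rb /\
    asymptotic ra (fun t => act g (a t)) /\ asymptotic rb (fun t => act g (b t)) /\
    c' < dbd ra rb.
End Group.
End Defs.

(* Main.v *)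
(** If [X] is not hyperbolic, cocompactness yields triangles having a point [p],
    near a fixed point, on one side and arbitrarily far from the other two sides.
    Projecting [p] to these sides and passing to the limit gives five rays from one
    point such that consecutive rays make a comparison angle at most pi/2 while the
    first and the last form a geodesic line; so two consecutive ones are distinct.
    Limits of the segments to the midpoints of [[a n, b n]] halve the angle between
    two distinct rays [a], [b], so there are distinct boundary points at arbitrarily
    small Tits angle.  The Tits angle bounds [d (ra s) (rb s) / s] for every
    translate, which makes the boundary distance of all translates small.

    If [X] is delta-hyperbolic and [a], [b] are distinct rays from one point, then
    for large [T] the point [a T] is delta-close to the segment [[a n, b n]] for
    every [n >= T].  Elements [g] moving [a T] close to [x0] leave every finite set,
    and the rays from [x0] to the endpoints of [g a], [g b] diverge at a speed that
    depends only on delta and on the cocompactness constant.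

    All limits are taken along a free ultrafilter on [nat]. *)
Require Import Defs.
From Stdlib Require Import Reals List Lra Lia Classical ClassicalChoice.
From Coquelicot Require Import Coquelicot.
From mathcomp Require filter.
Open Scope R_scope.

(** * Free ultrafilters on [nat] *)

Record free_ultrafilter (U : (nat -> Prop) -> Prop) : Prop := {
  uf_and : forall A B : nat -> Prop, U A -> U B -> U (fun n => A n /\ B n);
  uf_mono : forall A B : nat -> Prop, (forall n, A n -> B n) -> U A -> U B;
  uf_em : forall A : nat -> Prop, U A \/ U (fun n => ~ A n);
  uf_false : ~ U (fun _ => False);
  uf_tail : forall N, U (fun n => (N <= n)%nat) }.

Lemma free_ultrafilter_exists : exists U, free_ultrafilter U.
Proof.
  set (F := fun A : nat -> Prop => exists N, forall n, (N <= n)%nat -> A n).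
  assert (FF : filter.ProperFilter F).
  { apply filter.Build_ProperFilter.
    - intros [N HN]. exact (HN N (le_n N)).
    - apply filter.Build_Filter.
      + exists 0%nat. intros n _. exact I.
      + intros A B [N HN] [M HM]. exists (N + M)%nat. intros n Hn.
        split; [apply HN | apply HM]; lia.
      + intros A B HAB [N HN]. exists N. intros n Hn. apply HAB, HN, Hn. }
  destruct (@filter.ultraFilterLemma _ F FF) as [U [UU FU]].
  pose proof (@filter.ultra_proper _ _ UU) as PU.
  pose proof (@filter.filter_filter _ _ PU) as UF.
  exists U. constructor.
  - intros A B HA HB. exact (@filter.filterI _ _ UF A B HA HB).
  - intros A B HAB HA. exact (@filter.filterS _ _ UF A B HAB HA).
  - intros A. exact (filter.in_ultra_setVsetC A UU).
  - exact (@filter.filter_not_empty _ _ PU).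
  - intros N. apply FU. exists N. auto.
Qed.

Lemma uf_all U (HU : free_ultrafilter U) (A : nat -> Prop) : (forall n, A n) -> U A.
Proof.
  intros H. apply (uf_mono U HU) with (2 := uf_tail U HU 0). auto.
Qed.

Lemma uf_ex U (HU : free_ultrafilter U) (A : nat -> Prop) : U A -> exists n, A n.
Proof.
  intros HA. apply NNPP. intros HN. apply (uf_false U HU).
  apply (uf_mono U HU) with (2 := HA). intros n Hn. apply HN. exists n. exact Hn.
Qed.

(** An ultrafilter selects one of finitely many alternatives: if [P b] is not U-large, its
    complement is, and the rest of the list still covers. This is how finite subcovers and finite
    sets of group elements enter limit arguments. *)
Lemma uf_list U (HU : free_ultrafilter U) (T : Type) (l : list T) (P : T -> nat -> Prop) :
  U (fun n => exists b, In b l /\ P b n) -> exists b, In b l /\ U (P b).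
Proof.
  induction l as [|b l IH]; intros H.
  - destruct (uf_ex U HU _ H) as [n [b [[] _]]].
  - destruct (uf_em U HU (P b)) as [Hb|Hb].
    + exists b. split; [left; reflexivity | exact Hb].
    + destruct IH as [b' [Hin Hb']].
      * apply (uf_mono U HU) with (2 := uf_and U HU _ _ H Hb).
        intros n [[b' [[<-|Hin] Hb']] Hn]; [contradiction|]. exists b'. auto.
      * exists b'. split; [right; exact Hin | exact Hb'].
Qed.

(** * Ultralimits of points in a metric space *)

Definition ulim (U : (nat -> Prop) -> Prop) (X : Type) (d : X -> X -> R)
  (x : nat -> X) (l : X) : Prop :=
  forall e, 0 < e -> U (fun n => d (x n) l < e).

Section Metric.
Variables (X : Type) (d : X -> X -> R).
Hypothesis Hm : is_metric X d.

Lemma metric_refl x : d x x = 0.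
Proof. apply (proj1 Hm). reflexivity. Qed.

Lemma metric_eq0 x y : d x y = 0 -> x = y.
Proof. apply (proj1 Hm). Qed.

Lemma metric_sym x y : d x y = d y x.
Proof. apply (proj1 (proj2 Hm)). Qed.

Lemma metric_tri x y z : d x z <= d x y + d y z.
Proof. apply (proj2 (proj2 Hm)). Qed.

Lemma metric_nonneg x y : 0 <= d x y.
Proof.
  pose proof (metric_tri x y x) as H. rewrite metric_refl, (metric_sym y x) in H. lra.
Qed.

Section Ultralimits.
Variable U : (nat -> Prop) -> Prop.
Hypothesis HU : free_ultrafilter U.

Lemma ulim_dist_ge (x y : nat -> X) l m M :
  ulim U X d x l -> ulim U X d y m -> U (fun n => M <= d (x n) (y n)) -> M <= d l m.
Proof.
  intros Hx Hy HM. apply Rnot_lt_le. intros Hlt.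
  set (e := (M - d l m) / 2). assert (He : 0 < e) by (unfold e; lra).
  destruct (uf_ex U HU _ (uf_and U HU _ _ HM (uf_and U HU _ _ (Hx e He) (Hy e He))))
    as [n [H1 [H2 H3]]].
  pose proof (metric_tri (x n) l (y n)). pose proof (metric_tri l m (y n)).
  rewrite (metric_sym m (y n)) in *. unfold e in *. lra.
Qed.

Lemma ulim_dist_le (x y : nat -> X) l m M :
  ulim U X d x l -> ulim U X d y m -> U (fun n => d (x n) (y n) <= M) -> d l m <= M.
Proof.
  intros Hx Hy HM. apply Rnot_lt_le. intros Hlt.
  set (e := (d l m - M) / 2). assert (He : 0 < e) by (unfold e; lra).
  destruct (uf_ex U HU _ (uf_and U HU _ _ HM (uf_and U HU _ _ (Hx e He) (Hy e He))))
    as [n [H1 [H2 H3]]].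
  pose proof (metric_tri l (x n) m). pose proof (metric_tri (x n) (y n) m).
  rewrite (metric_sym l (x n)) in *. unfold e in *. lra.
Qed.

Lemma ulim_sqr_dist_le (x y : nat -> X) l m M :
  ulim U X d x l -> ulim U X d y m -> U (fun n => d (x n) (y n) ^ 2 <= M) ->
  d l m ^ 2 <= M.
Proof.
  intros Hx Hy HM.
  assert (H0 : 0 <= M).
  { destruct (uf_ex U HU _ HM) as [n Hn]. pose proof (pow2_ge_0 (d (x n) (y n))). lra. }
  rewrite <- (pow2_sqrt M H0). apply pow_incr. split; [apply metric_nonneg|].
  apply (ulim_dist_le x y l m _ Hx Hy).
  apply (uf_mono U HU) with (2 := HM). intros n Hn.
  rewrite <- (sqrt_pow2 (d (x n) (y n))) by apply metric_nonneg. apply sqrt_le_1_alt, Hn.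
Qed.

Lemma ulim_const x : ulim U X d (fun _ => x) x.
Proof. intros e He. apply uf_all; [exact HU|]. intros _. rewrite metric_refl. exact He. Qed.

Lemma ulim_unique (x : nat -> X) l m : ulim U X d x l -> ulim U X d x m -> l = m.
Proof.
  intros Hl Hr. apply metric_eq0. apply Rle_antisym; [|apply metric_nonneg].
  apply (ulim_dist_le x x l m 0 Hl Hr). apply uf_all; [exact HU|].
  intros n. rewrite metric_refl. lra.
Qed.

(** Otherwise every point of [K] has a ball that is not U-large for [x]; finitely many such balls
    cover [K], and [uf_list] makes one of them U-large. *)
Lemma compact_ulim (K : X -> Prop) (x : nat -> X) :
  Defs.compact X d K -> (forall n, K (x n)) -> exists k, K k /\ ulim U X d x k.
Proof.
  intros HK Hx. apply NNPP. intros HN.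
  destruct (HK (fun V => is_open X d V /\ ~ U (fun n => V (x n)))) as [l [Hl1 Hl2]].
  - intros V [HV _]. exact HV.
  - intros k Hk.
    assert (He : exists e, 0 < e /\ ~ U (fun n => d (x n) k < e)).
    { apply NNPP. intros He. apply HN. exists k. split; [exact Hk|].
      intros e He'. apply NNPP. intros Hu. apply He. exists e. auto. }
    destruct He as [e [He1 He2]].
    exists (fun z => d z k < e). split; [split|].
    + intros z Hz. exists (e - d z k). split; [lra|]. intros w Hw.
      pose proof (metric_tri w z k). rewrite (metric_sym w z) in *. lra.
    + exact He2.
    + rewrite metric_refl. exact He1.
  - destruct (uf_list U HU _ l (fun V n => V (x n))) as [V [HV1 HV2]].
    + apply uf_all; [exact HU|]. intros n. apply Hl2, Hx.
    + apply (Hl1 V HV1). exact HV2.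
Qed.

End Ultralimits.

(** * Geodesic segments, rays and asymptoticity *)

Lemma geodesic_seg_dist x y s t u :
  geodesic_seg X d x y s -> 0 <= t <= d x y -> 0 <= u <= d x y ->
  d (s t) (s u) = Rabs (t - u).
Proof. intros [_ [_ H]]. apply H. Qed.

Lemma geodesic_seg_dist_left x y s t :
  geodesic_seg X d x y s -> 0 <= t <= d x y -> d x (s t) = t.
Proof.
  intros Hs Ht. rewrite <- (proj1 Hs) at 1.
  rewrite (geodesic_seg_dist x y) by (try assumption; lra).
  rewrite Rabs_left1; lra.
Qed.

Lemma geodesic_seg_dist_right x y s t :
  geodesic_seg X d x y s -> 0 <= t <= d x y -> d (s t) y = d x y - t.
Proof.
  intros Hs Ht. rewrite <- (proj1 (proj2 Hs)) at 1.
  rewrite (geodesic_seg_dist x y) by (try assumption; lra).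
  rewrite Rabs_left1; lra.
Qed.

Lemma geodesic_seg_suffix x y s t :
  geodesic_seg X d x y s -> 0 <= t <= d x y ->
  geodesic_seg X d (s t) y (fun u => s (t + u)).
Proof.
  intros Hs Ht. pose proof (geodesic_seg_dist_right x y s t Hs Ht) as HL.
  split; [|split].
  - f_equal. lra.
  - rewrite HL. replace (t + (d x y - t)) with (d x y) by lra. apply Hs.
  - rewrite HL. intros u v Hu Hv. rewrite (geodesic_seg_dist x y) by (try assumption; lra).
    f_equal. lra.
Qed.

Lemma geodesic_seg_rev x y s :
  geodesic_seg X d x y s -> geodesic_seg X d y x (fun t => s (d x y - t)).
Proof.
  intros Hs. rewrite (metric_sym x y). split; [|split].
  - rewrite Rminus_0_r, (metric_sym y x). apply Hs.
  - rewrite Rminus_diag. apply Hs.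
  - intros t u Ht Hu. rewrite (metric_sym y x) in *.
    rewrite (geodesic_seg_dist x y) by (try assumption; lra).
    rewrite Rabs_minus_sym. f_equal. lra.
Qed.

Lemma geodesic_seg_prefix_rev x y s t :
  geodesic_seg X d x y s -> 0 <= t <= d x y ->
  geodesic_seg X d (s t) x (fun u => s (t - u)).
Proof.
  intros Hs Ht. assert (HL : d (s t) x = t).
  { rewrite metric_sym. apply (geodesic_seg_dist_left x y); assumption. }
  split; [|split]; rewrite ?HL.
  - f_equal. lra.
  - rewrite Rminus_diag. apply Hs.
  - intros u v Hu Hv. rewrite (geodesic_seg_dist x y) by (try assumption; lra).
    rewrite Rabs_minus_sym. f_equal. lra.
Qed.

Lemma ray_dist0 r t : geodesic_ray X d r -> 0 <= t -> d (r 0) (r t) = t.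
Proof. intros Hr Ht. rewrite Hr by lra. rewrite Rabs_left1; lra. Qed.

Lemma ray_seg r t : geodesic_ray X d r -> 0 <= t -> geodesic_seg X d (r 0) (r t) r.
Proof.
  intros Hr Ht. pose proof (ray_dist0 r t Hr Ht) as HL.
  split; [reflexivity|split].
  - rewrite HL. reflexivity.
  - intros u v Hu Hv. apply Hr; lra.
Qed.

Lemma asymptotic_sym r s : asymptotic X d r s -> asymptotic X d s r.
Proof.
  intros [K HK]. exists K. intros t Ht. rewrite metric_sym. apply HK, Ht.
Qed.

Lemma asymptotic_trans r s q :
  asymptotic X d r s -> asymptotic X d s q -> asymptotic X d r q.
Proof.
  intros [K HK] [L HL]. exists (K + L). intros t Ht.
  pose proof (metric_tri (r t) (s t) (q t)). specialize (HK t Ht). specialize (HL t Ht). lra.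
Qed.

(** * CAT(0) comparison inequalities *)

Section CAT0.
Hypothesis Hcat : CAT0 X d.

Lemma dE2_sqr p q : dE2 p q ^ 2 = (fst p - fst q) ^ 2 + (snd p - snd q) ^ 2.
Proof.
  unfold dE2. apply pow2_sqrt. pose proof (pow2_ge_0 (fst p - fst q)).
  pose proof (pow2_ge_0 (snd p - snd q)). lra.
Qed.

Lemma dE2_eq p q A :
  0 <= A -> (fst p - fst q) ^ 2 + (snd p - snd q) ^ 2 = A ^ 2 -> dE2 p q = A.
Proof. intros HA H. unfold dE2. rewrite H. apply sqrt_pow2, HA. Qed.

(* The law of cosines in the comparison triangle: the quotient is twice the
   cosine of the comparison angle at [x]. *)
Lemma cat0_cosine x y z sy sz A B C t u :
  geodesic_seg X d x y sy -> geodesic_seg X d x z sz ->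
  d x y = A -> d x z = B -> d y z = C -> 0 < A -> 0 < B ->
  0 <= t <= A -> 0 <= u <= B ->
  d (sy t) (sz u) ^ 2 <= t ^ 2 + u ^ 2 - t * u * ((A ^ 2 + B ^ 2 - C ^ 2) / (A * B)).
Proof.
  intros Hy Hz HA HB HC A0 B0 Ht Hu.
  assert (T1 : C <= A + B).
  { pose proof (metric_tri y x z). rewrite (metric_sym y x) in *. lra. }
  assert (T2 : A <= B + C).
  { pose proof (metric_tri x z y). rewrite (metric_sym z y) in *. lra. }
  assert (T3 : B <= A + C) by (pose proof (metric_tri x y z); lra).
  (* The comparison triangle is [(0, 0)], [(A, 0)], [(p, q)], with [p] given by the law of cosines;
     the triangle inequalities give [p ^ 2 <= B ^ 2], so [q] exists. *)
  set (p := (A ^ 2 + B ^ 2 - C ^ 2) / (2 * A)).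
  assert (Hp : 2 * A * p = A ^ 2 + B ^ 2 - C ^ 2) by (unfold p; field; lra).
  assert (Hpp : 0 <= B ^ 2 - p ^ 2).
  { assert (p <= B) by (apply Rmult_le_reg_l with (2 * A); nra).
    assert (- B <= p) by (apply Rmult_le_reg_l with (2 * A); nra). nra. }
  set (q := sqrt (B ^ 2 - p ^ 2)).
  assert (Hq : q ^ 2 = B ^ 2 - p ^ 2) by (apply pow2_sqrt, Hpp).
  assert (HC0 : 0 <= C) by (rewrite <- HC; apply metric_nonneg).
  pose proof (proj2 Hcat x y z sy sz Hy Hz (0, 0) (A, 0) (p, q)) as H.
  rewrite HA, HB, HC in H.
  specialize (H ltac:(apply dE2_eq; simpl; lra) ltac:(apply dE2_eq; simpl fst; simpl snd; nra)
                ltac:(apply dE2_eq; simpl fst; simpl snd; nra) t u Ht Hu).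
  apply Rle_trans with (dE2 (seg_pt (0, 0) (A, 0) A t) (seg_pt (0, 0) (p, q) B u) ^ 2).
  - apply pow_incr. split; [apply metric_nonneg | exact H].
  - rewrite dE2_sqr. unfold seg_pt. simpl fst. simpl snd.
    replace ((A ^ 2 + B ^ 2 - C ^ 2) / (A * B)) with (2 * p / B) by (unfold p; field; lra).
    apply Req_le.
    transitivity (t ^ 2 - 2 * t * u * p / B + (u / B) ^ 2 * (p ^ 2 + q ^ 2)).
    + field; lra.
    + rewrite Hq. field; lra.
Qed.

(** With [t = l * A] and [u = l * B] the right side of [cat0_cosine] collapses to [(l * C) ^ 2]. *)
Lemma cat0_scale x y z sy sz l :
  geodesic_seg X d x y sy -> geodesic_seg X d x z sz ->
  0 < d x y -> 0 < d x z -> 0 <= l <= 1 ->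
  d (sy (l * d x y)) (sz (l * d x z)) <= l * d y z.
Proof.
  intros Hy Hz HA HB Hl.
  pose proof (cat0_cosine x y z sy sz _ _ _ (l * d x y) (l * d x z) Hy Hz
    eq_refl eq_refl eq_refl HA HB ltac:(nra) ltac:(nra)) as H.
  pose proof (metric_nonneg y z).
  apply Rsqr_incr_0_var; [|nra].
  unfold Rsqr. replace (l * d y z * (l * d y z)) with
   ((l * d x y) ^ 2 + (l * d x z) ^ 2 - l * d x y * (l * d x z) *
     ((d x y ^ 2 + d x z ^ 2 - d y z ^ 2) / (d x y * d x z))) by (field; lra).
  simpl in H |- *. lra.
Qed.

(** Convexity: [d (a t) (b t) / t] is nondecreasing, by scaling the triangle [o], [a t], [b t] by
    [s / t]. *)
Lemma ray_ratio_mono o a b s t :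
  ray_from X d o a -> ray_from X d o b -> 0 <= s <= t -> 0 < t ->
  d (a s) (b s) <= s / t * d (a t) (b t).
Proof.
  intros [Ha Ha0] [Hb Hb0] Hs Ht.
  pose proof (ray_seg a t Ha ltac:(lra)) as Sa. pose proof (ray_seg b t Hb ltac:(lra)) as Sb.
  pose proof (ray_dist0 a t Ha ltac:(lra)) as Da. pose proof (ray_dist0 b t Hb ltac:(lra)) as Db.
  rewrite Ha0 in *. rewrite Hb0 in *.
  pose proof (cat0_scale _ _ _ _ _ (s / t) Sa Sb) as H. rewrite Da, Db in H.
  replace (s / t * t) with s in H by (field; lra). apply H; try lra. split.
  - apply Rdiv_le_0_compat; lra.
  - apply Rmult_le_reg_r with t; [lra|]. unfold Rdiv. rewrite Rmult_assoc, Rinv_l; lra.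
Qed.

End CAT0.
End Metric.

(** * Spaces with a geometric action: uniform constants and limits of bounded sequences *)

(** Properness of [X] in the form in which it is used: bounded sequences have ultralimits. *)
Definition bounded_ulims (U : (nat -> Prop) -> Prop) (X : Type) (d : X -> X -> R) : Prop :=
  forall (o : X) (r : R) (x : nat -> X), U (fun n => d o (x n) <= r) -> exists l, ulim U X d x l.

Section GeometricAction.
Variables (X : Type) (d : X -> X -> R).
Hypothesis Hm : is_metric X d.
Hypothesis Hgeo : geodesic_space X d.
Variables (G : Type) (mul : G -> G -> G) (one : G) (inv : G -> G) (act : G -> X -> X).
Hypothesis HG : is_group G mul one inv.
Hypothesis Hact : geometric_action X d G mul one act.

Lemma act_isometry g x y : d (act g x) (act g y) = d x y.
Proof. apply Hact. Qed.

Lemma act_inv_l g x : act (inv g) (act g x) = x.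
Proof.
  destruct Hact as [[H1 [H2 _]] _]. rewrite <- H2.
  destruct HG as [_ [_ [_ [Hl _]]]]. rewrite Hl. apply H1.
Qed.

Lemma act_inv_r g x : act g (act (inv g) x) = x.
Proof.
  destruct Hact as [[H1 [H2 _]] _]. rewrite <- H2.
  destruct HG as [_ [_ [_ [_ Hr]]]]. rewrite Hr. apply H1.
Qed.

Lemma is_open_ball x r : is_open X d (fun y => d x y < r).
Proof.
  intros y Hy. exists (r - d x y). split; [lra|]. intros z Hz.
  pose proof (metric_tri X d Hm x y z). lra.
Qed.

(** A Lebesgue number argument: cover [K] by balls of half the properness radius and let [rho] be
    the least half-radius in a finite subcover. The [rho]-ball at [k] then lies in the full ball of
    some centre. *)
Lemma proper_radius_uniform K :
  Defs.compact X d K ->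
  exists rho, 0 < rho /\ forall k, K k ->
    finite_set G (fun g => exists y, d k y < rho /\ d k (act g y) < rho).
Proof.
  intros HK.
  set (P := fun x r => 0 < r /\ finite_set G (fun g => exists y, d x y < r /\ d x (act g y) < r)).
  destruct (HK (fun V => exists x r, P x r /\ V = (fun y => d x y < r / 2))) as [l [Hl1 Hl2]].
  - intros V [x [r [_ ->]]]. apply is_open_ball.
  - intros x _. destruct (proj1 (proj2 Hact) x) as [r Hr].
    exists (fun y => d x y < r / 2). split.
    + exists x, r. split; [exact Hr | reflexivity].
    + rewrite metric_refl by exact Hm. destruct Hr as [Hr _]. lra.
  - assert (H : exists rho, 0 < rho /\ forall V, In V l -> forall k, V k ->
      finite_set G (fun g => exists y, d k y < rho /\ d k (act g y) < rho)).
    { clear Hl2. induction l as [|V l IH].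
      - exists 1. split; [lra|]. intros V [].
      - destruct IH as [rho [H0 H1]]; [intros W HW; apply Hl1; right; exact HW|].
        destruct (Hl1 V (or_introl eq_refl)) as [x [r [[Hr [L HL]] HV]]].
        exists (Rmin rho (r / 2)). split; [apply Rmin_glb_lt; lra|].
        pose proof (Rmin_l rho (r / 2)). pose proof (Rmin_r rho (r / 2)).
        intros W [<-|HW] k Hk.
        + exists L. intros g [y [Hy1 Hy2]]. apply HL. exists y. rewrite HV in Hk.
          pose proof (metric_tri X d Hm x k y). pose proof (metric_tri X d Hm x k (act g y)).
          split; lra.
        + destruct (H1 W HW k Hk) as [M HM]. exists M. intros g [y [Hy1 Hy2]].
          apply HM. exists y. split; lra. }
    destruct H as [rho [H0 H1]]. exists rho. split; [exact H0|]. intros k Hk.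
    destruct (Hl2 k Hk) as [V [HV1 HV2]]. apply (H1 V HV1 k HV2).
Qed.

(** [K] is bounded, being covered by finitely many balls of integer radius about [x0], and [inv g]
    carries [act g k] back into [K]. *)
Lemma cocompact_bound x0 : exists D, 0 < D /\ forall x, exists g, d (act g x) x0 < D.
Proof.
  destruct Hact as [_ [_ [K [HK Hc]]]].
  destruct (HK (fun V => exists n : nat, V = (fun y => d x0 y < INR n))) as [l [Hl1 Hl2]].
  - intros V [n ->]. apply is_open_ball.
  - intros x _. destruct (INR_unbounded (d x0 x)) as [n Hn].
    exists (fun y => d x0 y < INR n). split; [exists n; reflexivity | exact Hn].
  - assert (H : exists D, 0 < D /\ forall V, In V l -> forall k, V k -> d x0 k < D).
    { clear Hl2. induction l as [|V l IH].
      - exists 1. split; [lra|]. intros V [].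
      - destruct IH as [D [H0 H1]]; [intros W HW; apply Hl1; right; exact HW|].
        destruct (Hl1 V (or_introl eq_refl)) as [n HV].
        exists (Rmax D (INR n)). pose proof (Rmax_l D (INR n)). pose proof (Rmax_r D (INR n)).
        split; [lra|].
        intros W [<-|HW] k Hk.
        + rewrite HV in Hk. lra.
        + specialize (H1 W HW k Hk). lra. }
    destruct H as [D [H0 H1]]. exists D. split; [exact H0|]. intros x.
    destruct (Hc x) as [g [k [Hk ->]]]. exists (inv g). rewrite act_inv_l, (metric_sym X d Hm).
    destruct (Hl2 k Hk) as [V [HV1 HV2]]. apply (H1 V HV1 k HV2).
Qed.

Section Limits.
Variable U : (nat -> Prop) -> Prop.
Hypothesis HU : free_ultrafilter U.

(* If [x n = g n k n] stays in a small ball and [k n] tends to [k], then the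
   elements [g m^-1 g n] move [k] by less than [rho], so [g n] is U-constant. *)
Lemma local_ulims :
  exists rho, 0 < rho /\
    forall y x, U (fun n => d (x n) y < rho) -> exists l, ulim U X d x l.
Proof.
  destruct Hact as [[_ [Hmul _]] [_ [K [HK Hc]]]].
  destruct (proper_radius_uniform K HK) as [rho [H0 Hfin]].
  (* [x n] is within [rho / 4] of [y] and [kk n] within [rho / 4] of [k], so the points
     [act (g n) k] are within [rho / 2] of [y] and within [rho] of each other. *)
  exists (rho / 4). split; [lra|]. intros y x Hx.
  assert (Hgk : exists gk : nat -> G * X, forall n, K (snd (gk n)) /\ x n = act (fst (gk n)) (snd (gk n))).
  { apply (choice (fun n (p : G * X) => K (snd p) /\ x n = act (fst p) (snd p))).
    intros n. destruct (Hc (x n)) as [g [k Hk]]. exists (g, k). exact Hk. }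
  destruct Hgk as [gk Hgk].
  set (g := fun n => fst (gk n)). set (kk := fun n => snd (gk n)).
  assert (Hxn : forall n, x n = act (g n) (kk n)) by (intros n; apply Hgk).
  destruct (compact_ulim X d Hm U HU K kk HK) as [k [Hk Hlim]]; [intros n; apply Hgk|].
  pose proof (uf_and U HU _ _ Hx (Hlim (rho / 4) ltac:(lra))) as HA.
  assert (HB : U (fun n => d (act (g n) k) y < rho / 2)).
  { apply (uf_mono U HU) with (2 := HA). intros n [H1 H2].
    pose proof (metric_tri X d Hm (act (g n) k) (x n) y) as H3.
    rewrite Hxn, act_isometry, (metric_sym X d Hm k) in H3. rewrite Hxn in H1. lra. }
  destruct (uf_ex U HU _ HB) as [m Hmm].
  destruct (Hfin k Hk) as [L HL].
  destruct (uf_list U HU G L (fun h n => mul (inv (g m)) (g n) = h)) as [h [_ Hh]].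
  { apply (uf_mono U HU) with (2 := HB). intros n Hn.
    exists (mul (inv (g m)) (g n)). split; [|reflexivity].
    apply HL. exists k. rewrite metric_refl by exact Hm. split; [exact H0|].
    rewrite Hmul, <- (act_isometry (g m)), act_inv_r.
    pose proof (metric_tri X d Hm (act (g m) k) y (act (g n) k)) as H3.
    rewrite (metric_sym X d Hm y) in H3. lra. }
  (* For U-most [n], [h] is the value of [mul (inv (g m)) (g n)], so [g n] acts as [g m] after
     [h]. *)
  exists (act (g m) (act h k)). intros e He.
  apply (uf_mono U HU) with (2 := uf_and U HU _ _ Hh (Hlim e He)).
  intros n [<- Hn]. rewrite Hmul, act_inv_r, Hxn, act_isometry. exact Hn.
Qed.

(* Hopf-Rinow: points at distance at most [(j+1) rho / 2] are within [rho / 2]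
   of points at distance at most [j rho / 2]. *)
Lemma geometric_bounded_ulims : bounded_ulims U X d.
Proof.
  destruct local_ulims as [rho [H0 Hloc]]. intros o r.
  assert (Hj : forall j x, U (fun n => d o (x n) <= INR j * (rho / 2)) ->
            exists l, ulim U X d x l).
  { induction j as [|j IH]; intros x Hx.
    - exists o. intros e He. apply (uf_mono U HU) with (2 := Hx). intros n Hn.
      simpl in Hn. rewrite (metric_sym X d Hm). lra.
    - destruct (choice (fun n s => geodesic_seg X d o (x n) s) (fun n => Hgeo o (x n))) as [s Hs].
      (* The geodesic to [x n] is cut at distance [j rho / 2]; the cut points converge to some [l]
         by induction, and [x n] is within [rho] of [l]. *)
      set (t := fun n => Rmin (d o (x n)) (INR j * (rho / 2))).
      assert (Hj0 : 0 <= INR j * (rho / 2)) by (pose proof (pos_INR j); nra).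
      assert (Ht : forall n, 0 <= t n <= d o (x n)).
      { intros n. unfold t. split; [|apply Rmin_l].
        apply Rmin_glb; [apply metric_nonneg, Hm | exact Hj0]. }
      destruct (IH (fun n => s n (t n))) as [l Hl].
      { apply uf_all; [exact HU|]. intros n.
        rewrite (geodesic_seg_dist_left X d o (x n)) by auto. apply Rmin_r. }
      apply (Hloc l). apply (uf_mono U HU) with (2 := uf_and U HU _ _ Hx (Hl (rho / 2) ltac:(lra))).
      intros n [H1 H2]. pose proof (metric_tri X d Hm (x n) (s n (t n)) l) as H3.
      rewrite (metric_sym X d Hm (x n) (s n (t n))), (geodesic_seg_dist_right X d o (x n)) in H3 by auto.
      rewrite S_INR in H1. unfold t in H2, H3. revert H2 H3. unfold Rmin.
      destruct (Rle_dec (d o (x n)) (INR j * (rho / 2))); lra. }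
  intros x Hx. destruct (INR_unbounded (r / (rho / 2))) as [j HjN].
  apply (Hj j). apply (uf_mono U HU) with (2 := Hx). intros n Hn.
  apply Rle_trans with (1 := Hn). left. apply Rmult_lt_reg_r with (/ (rho / 2)).
  - apply Rinv_0_lt_compat. lra.
  - rewrite Rmult_assoc, Rinv_r by lra. unfold Rdiv in HjN |- *. lra.
Qed.

End Limits.
End GeometricAction.

(** * Limit rays and the angle between rays from one point *)

Lemma uf_INR U (HU : free_ultrafilter U) r : U (fun n => r <= INR n).
Proof.
  destruct (INR_unbounded r) as [N HN]. apply (uf_mono U HU) with (2 := uf_tail U HU N).
  intros n Hn. apply le_INR in Hn. lra.
Qed.

(** In a Euclidean sector of angle theta the chord satisfies this with equality for
    [kappa = 4 sin^2 (theta/2)]. For rays from one point it thus bounds the angle at infinity;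
    [kappa = 2] is pi/2. *)
Definition chord_le (X : Type) (d : X -> X -> R) (kappa : R) (a b : R -> X) : Prop :=
  forall s, 0 <= s -> d (a s) (b s) ^ 2 <= kappa * s ^ 2.

Section LimitRays.
Variables (X : Type) (d : X -> X -> R).
Hypothesis Hm : is_metric X d.
Hypothesis Hcat : CAT0 X d.
Variable U : (nat -> Prop) -> Prop.
Hypothesis HU : free_ultrafilter U.
Hypothesis HL : bounded_ulims U X d.

(** Segments whose lengths exceed every bound along [U] converge pointwise. The starting points may
    vary, as they do for fat triangles. *)
Lemma limit_ray o (p e : nat -> X) (f : nat -> R -> X) :
  ulim U X d p o -> (forall n, geodesic_seg X d (p n) (e n) (f n)) ->
  (forall t, U (fun n => t <= d (p n) (e n))) ->
  exists r, ray_from X d o r /\ forall t, 0 <= t -> ulim U X d (fun n => f n t) (r t).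
Proof.
  intros Hp Hf Ht.
  destruct (choice (fun t l => 0 <= t -> ulim U X d (fun n => f n t) l)) as [r Hr].
  (* At negative parameters [o] is a default value. *)
  { intros t. destruct (Rle_dec 0 t) as [H0|H0]; [|exists o; intros; contradiction].
    destruct (HL o (1 + t) (fun n => f n t)) as [l Hl]; [|exists l; auto].
    apply (uf_mono U HU) with (2 := uf_and U HU _ _ (Hp 1 Rlt_0_1) (Ht t)).
    intros n [H1 H2]. pose proof (metric_tri X d Hm o (p n) (f n t)) as H3.
    rewrite (metric_sym X d Hm o (p n)), (geodesic_seg_dist_left X d (p n) (e n)) in H3;
      [lra | apply Hf | lra]. }
  exists r. split; [|exact Hr]. split.
  - intros t u H1 H2.
    assert (HA : U (fun n => d (f n t) (f n u) = Rabs (t - u))).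
    { apply (uf_mono U HU) with (2 := uf_and U HU _ _ (Ht t) (Ht u)). intros n [H3 H4].
      apply (geodesic_seg_dist X d (p n) (e n)); [apply Hf | lra | lra]. }
    apply Rle_antisym.
    + apply (ulim_dist_le X d Hm U HU _ _ _ _ _ (Hr t H1) (Hr u H2)).
      apply (uf_mono U HU) with (2 := HA). intros n ->. lra.
    + apply (ulim_dist_ge X d Hm U HU _ _ _ _ _ (Hr t H1) (Hr u H2)).
      apply (uf_mono U HU) with (2 := HA). intros n ->. lra.
  - apply (ulim_unique X d Hm U HU (fun n => f n 0)); [apply Hr; lra|].
    intros e' He. apply (uf_mono U HU) with (2 := Hp e' He). intros n Hn.
    rewrite (proj1 (Hf n)). exact Hn.
Qed.

(** Shrinking the triangle towards the common endpoint [a (INR n)] keeps corresponding points within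
    [D]; the two sides differ in length by at most [D], so matching parameters costs another [D]. *)
Lemma limit_ray_asymptotic x a (f : nat -> R -> X) :
  geodesic_ray X d a -> (forall n, geodesic_seg X d x (a (INR n)) (f n)) ->
  exists r, ray_from X d x r /\ asymptotic X d r a /\
    forall t, 0 <= t -> ulim U X d (fun n => f n t) (r t).
Proof.
  intros Ha Hf. set (D := d x (a 0)). set (L := fun n => d x (a (INR n))).
  assert (HD : 0 <= D) by apply metric_nonneg, Hm.
  assert (HLn : forall n, INR n - D <= L n <= INR n + D).
  { intros n. unfold L, D. pose proof (ray_dist0 X d a (INR n) Ha (pos_INR n)) as H.
    pose proof (metric_tri X d Hm x (a 0) (a (INR n))).
    pose proof (metric_tri X d Hm (a 0) x (a (INR n))) as H1.
    rewrite (metric_sym X d Hm (a 0) x) in H1. lra. }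
  assert (HLt : forall t, U (fun n => t <= L n)).
  { intros t. apply (uf_mono U HU) with (2 := uf_INR U HU (t + D)). intros n Hn.
    specialize (HLn n). lra. }
  destruct (limit_ray x (fun _ => x) (fun n => a (INR n)) f) as [r [Hr Hlim]];
    [apply ulim_const; assumption | exact Hf | exact HLt |].
  exists r. split; [exact Hr | split; [|exact Hlim]].
  exists (2 * D). intros t Ht.
  apply (ulim_dist_le X d Hm U HU _ _ _ _ _ (Hlim t Ht) (ulim_const X d Hm U HU (a t))).
  apply (uf_mono U HU) with (2 := uf_and U HU _ _ (uf_INR U HU 1) (HLt (t + 1))).
  intros n [H1 H2]. specialize (HLn n).
  (* The scaling ratio is measured from [a (INR n)], hence the complement of [t / L n]. *)
  set (l := 1 - t / L n).
  assert (Hl : 0 <= t / L n <= 1).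
  { split; [apply Rdiv_le_0_compat; lra|]. apply Rmult_le_reg_r with (L n); [lra|].
    unfold Rdiv. rewrite Rmult_assoc, Rinv_l; lra. }
  assert (HtL : t / L n * L n = t) by (field; lra).
  pose proof (geodesic_seg_rev X d Hm _ _ _ (Hf n)) as S1.
  pose proof (geodesic_seg_rev X d Hm _ _ _ (ray_seg X d a (INR n) Ha (pos_INR n))) as S2.
  pose proof (cat0_scale X d Hm Hcat _ _ _ _ _ l S1 S2) as H.
  rewrite (metric_sym X d Hm (a (INR n)) x), (metric_sym X d Hm (a (INR n)) (a 0)) in H.
  rewrite (ray_dist0 X d a (INR n) Ha (pos_INR n)) in H. fold (L n) D in H.
  specialize (H ltac:(lra) ltac:(lra) ltac:(unfold l; lra)).
  replace (L n - l * L n) with t in H by (unfold l; lra).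
  replace (INR n - l * INR n) with (t / L n * INR n) in H by (unfold l; lra).
  pose proof (metric_tri X d Hm (f n t) (a (t / L n * INR n)) (a t)) as H3.
  rewrite (Ha (t / L n * INR n) t) in H3 by nra.
  assert (Rabs (t / L n * INR n - t) <= D).
  { rewrite <- HtL at 2. rewrite <- Rmult_minus_distr_l, Rabs_mult.
    rewrite (Rabs_right (t / L n)) by lra.
    assert (Rabs (INR n - L n) <= D) by (apply Rabs_le; lra).
    pose proof (Rabs_pos (INR n - L n)). nra. }
  assert (l * D <= D) by (unfold l; nra). lra.
Qed.

Lemma ray_from_exists x a :
  geodesic_ray X d a -> exists r, ray_from X d x r /\ asymptotic X d r a.
Proof.
  intros Ha. destruct (choice (fun n s => geodesic_seg X d x (a (INR n)) s)
    (fun n => proj1 Hcat x (a (INR n)))) as [f Hf].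
  destruct (limit_ray_asymptotic x a f Ha Hf) as [r [H1 [H2 _]]]. exists r. auto.
Qed.

(** The last hypothesis is [2 - kappa <= 2 cos] for the comparison angle at [o], cleared of its
    denominator; [cat0_cosine] with both parameters equal to [s] concludes. *)
Lemma cat0_chord o y z f h kappa s :
  geodesic_seg X d o y f -> geodesic_seg X d o z h ->
  0 < d o y -> 0 < d o z -> 0 <= s <= d o y -> s <= d o z ->
  (2 - kappa) * (d o y * d o z) <= d o y ^ 2 + d o z ^ 2 - d y z ^ 2 ->
  d (f s) (h s) ^ 2 <= kappa * s ^ 2.
Proof.
  intros Hf Hh HA HB Hs1 Hs2 HC.
  pose proof (cat0_cosine X d Hm Hcat _ _ _ _ _ _ _ _ s s Hf Hh
    eq_refl eq_refl eq_refl HA HB Hs1 ltac:(lra)) as H.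
  set (Q := (d o y ^ 2 + d o z ^ 2 - d y z ^ 2) / (d o y * d o z)) in *.
  assert (HQ : 2 - kappa <= Q).
  { apply Rmult_le_reg_r with (d o y * d o z); [nra|]. unfold Q, Rdiv.
    rewrite (Rmult_assoc _ (/ _)), Rinv_l by nra. lra. }
  nra.
Qed.

(* For [kappa = 4 sin^2 (theta/2)] the midpoint ray makes angle at most
   [theta/2] with both rays, and [4 sin^2 (theta/4) <= kappa/2]. *)
Lemma halve_chord o a b kappa :
  ray_from X d o a -> ray_from X d o b -> ~ asymptotic X d a b ->
  0 <= kappa <= 2 -> chord_le X d kappa a b ->
  exists a' b', ray_from X d o a' /\ ray_from X d o b' /\ ~ asymptotic X d a' b' /\
    chord_le X d (kappa / 2) a' b'.
Proof.
  intros [Ha Ha0] [Hb Hb0] Hab Hk Hc.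
  destruct (choice (fun n s => geodesic_seg X d (a (INR n)) (b (INR n)) s)
    (fun n => proj1 Hcat _ _)) as [sg Hsg].
  set (L := fun n => d (a (INR n)) (b (INR n))). set (m := fun n => sg n (L n / 2)).
  assert (HL0 : forall n, 0 <= L n) by (intros n; apply metric_nonneg, Hm).
  assert (HL2 : forall n, L n ^ 2 <= kappa * INR n ^ 2).
  { intros n. apply Hc, pos_INR. }
  assert (Hma : forall n, d (a (INR n)) (m n) = L n / 2).
  { intros n. apply (geodesic_seg_dist_left X d _ _ _ _ (Hsg n)).
    specialize (HL0 n). fold (L n). lra. }
  assert (Hmb : forall n, d (b (INR n)) (m n) = L n / 2).
  { intros n. rewrite (metric_sym X d Hm). unfold m.
    rewrite (geodesic_seg_dist_right X d _ _ _ _ (Hsg n)); specialize (HL0 n); fold (L n); lra. }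
  assert (Hoa : forall n, d o (a (INR n)) = INR n).
  { intros n. rewrite <- Ha0. apply ray_dist0; [exact Ha | apply pos_INR]. }
  assert (Hob : forall n, d o (b (INR n)) = INR n).
  { intros n. rewrite <- Hb0. apply ray_dist0; [exact Hb | apply pos_INR]. }
  (* Since [kappa <= 2], [L n <= 3/2 n], so the midpoints leave every ball and their segments have a
     limit ray [c]. *)
  assert (HB : forall n, INR n / 4 <= d o (m n)).
  { intros n. pose proof (metric_tri X d Hm o (m n) (a (INR n))) as H.
    rewrite Hoa, (metric_sym X d Hm (m n)), Hma in H.
    specialize (HL0 n). specialize (HL2 n). pose proof (pos_INR n).
    assert (L n <= 3 / 2 * INR n) by nra. lra. }
  destruct (choice (fun n s => geodesic_seg X d o (m n) s)
    (fun n => proj1 Hcat _ _)) as [f Hf].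
  destruct (limit_ray o (fun _ => o) m f) as [c [Hcr Hlim]];
    [apply ulim_const; assumption | exact Hf | |].
  { intros t. apply (uf_mono U HU) with (2 := uf_INR U HU (4 * t)). intros n Hn.
    specialize (HB n). lra. }
  assert (key : forall r, geodesic_ray X d r -> r 0 = o -> (forall n, d o (r (INR n)) = INR n) ->
    (forall n, d (r (INR n)) (m n) = L n / 2) -> chord_le X d (kappa / 2) r c).
  { intros r Hr Hr0 Hor Hrm s Hs.
    apply (ulim_sqr_dist_le X d Hm U HU _ _ _ _ _ (ulim_const X d Hm U HU (r s)) (Hlim s Hs)).
    apply (uf_mono U HU) with (2 := uf_INR U HU (4 * (s + 1))). intros n Hn.
    specialize (HB n). specialize (HL2 n).
    pose proof (ray_seg X d r (INR n) Hr (pos_INR n)) as Sr. rewrite Hr0 in Sr.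
    apply (cat0_chord o (r (INR n)) (m n)); try assumption; rewrite ?Hor, ?Hrm; try lra;
      [apply Hf|].
    (* This sum of squares is the hypothesis of [cat0_chord] for [kappa / 2], after bounding
       [L n ^ 2] by [kappa n ^ 2]. *)
    assert (0 <= (1 - kappa / 4) * (INR n - d o (m n)) ^ 2 + kappa / 4 * d o (m n) ^ 2).
    { pose proof (pow2_ge_0 (INR n - d o (m n))). pose proof (pow2_ge_0 (d o (m n))). nra. }
    lra. }
  assert (Ka := key a Ha Ha0 Hoa Hma). assert (Kb := key b Hb Hb0 Hob Hmb).
  (* [c] cannot be asymptotic to both [a] and [b], so it pairs with one of them. *)
  destruct (classic (asymptotic X d a c)) as [H1|H1].
  - exists b, c. split; [split; assumption|]. split; [exact Hcr|]. split; [|exact Kb].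
    intros H2. apply Hab. apply (asymptotic_trans X d Hm a c b H1).
    apply (asymptotic_sym X d Hm), H2.
  - exists a, c. split; [split; assumption|]. auto.
Qed.

(** * Projection to a segment and the angles it creates *)

Lemma closest_point p y z s :
  geodesic_seg X d y z s ->
  exists t0, 0 <= t0 <= d y z /\ forall t, 0 <= t <= d y z -> d p (s t0) <= d p (s t).
Proof.
  intros Hs. pose proof (metric_nonneg X d Hm y z) as H0.
  (* Clamping the parameter gives a function continuous on all of [R], so that the extreme value
     theorem applies up to the endpoints. *)
  set (cl := fun t => Rmax 0 (Rmin t (d y z))).
  assert (Hcl : forall t, 0 <= cl t <= d y z).
  { intros t. unfold cl. split; [apply Rmax_l|]. apply Rmax_lub; [exact H0 | apply Rmin_r]. }
  assert (Hlip : forall t u, Rabs (cl t - cl u) <= Rabs (t - u)).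
  { intros t u. unfold cl, Rmax, Rmin.
    repeat destruct Rle_dec; unfold Rabs; repeat destruct Rcase_abs; lra. }
  destruct (continuity_ab_min (fun t => d p (s (cl t))) 0 (d y z) H0) as [t0 [Hmin Ht0]].
  - intros c _ e He. exists e. split; [exact He|]. intros x [_ Hx]. simpl in *.
    unfold R_dist in *. eapply Rle_lt_trans; [|exact Hx].
    apply Rle_trans with (2 := Hlip x c).
    rewrite <- (geodesic_seg_dist X d y z s (cl x) (cl c) Hs (Hcl x) (Hcl c)).
    pose proof (metric_tri X d Hm p (s (cl c)) (s (cl x))) as H1.
    pose proof (metric_tri X d Hm p (s (cl x)) (s (cl c))) as H2.
    rewrite (metric_sym X d Hm (s (cl c))) in H1. apply Rabs_le. lra.
  - exists t0. split; [exact Ht0|].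
    assert (Hid : forall t, 0 <= t <= d y z -> cl t = t).
    { intros t Ht. unfold cl. rewrite Rmin_left, Rmax_right; lra. }
    intros t Ht. specialize (Hmin t Ht). rewrite !Hid in Hmin by assumption. exact Hmin.
Qed.

(** First variation: if the comparison angle at the foot [q] were acute, a short step from [q]
    towards [y] would come closer to [p]. *)
Lemma foot_angle_obtuse p q y f :
  geodesic_seg X d q y f -> (forall u, 0 <= u <= d q y -> d p q <= d p (f u)) ->
  0 < d p q -> d p q ^ 2 + d q y ^ 2 <= d p y ^ 2.
Proof.
  intros Hf Hmin HB. destruct (Rle_lt_or_eq_dec 0 (d q y) (metric_nonneg X d Hm q y)) as [HC|HC].
  2: { assert (q = y) as <- by (apply (metric_eq0 X d Hm); auto). rewrite <- HC. lra. }
  apply Rnot_lt_le. intros Hlt.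
  destruct (proj1 Hcat q p) as [h Hh].
  set (B := d p q) in *. set (C := d q y) in *.
  assert (HqB : d q p = B) by apply (metric_sym X d Hm).
  (* [w] is [2 B cos] of the angle at [q]. The step [u] satisfies [u <= C] to stay on the segment
     and [u <= w / 2] to force [u ^ 2 - u * w < 0]. *)
  set (w := (B ^ 2 + C ^ 2 - d p y ^ 2) / C).
  assert (Hw : 0 < w) by (apply Rdiv_lt_0_compat; lra).
  set (u := Rmin C (w / 2)).
  assert (Hu : 0 < u) by (apply Rmin_glb_lt; lra).
  pose proof (Rmin_l C (w / 2)) as Hu1. pose proof (Rmin_r C (w / 2)) as Hu2.
  fold u in Hu1, Hu2.
  pose proof (cat0_cosine X d Hm Hcat _ _ _ _ _ C B (d y p) u B Hf Hh eq_refl HqB eq_refl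
    HC HB ltac:(lra) ltac:(lra)) as H.
  rewrite <- HqB in H at 1. rewrite (proj1 (proj2 Hh)) in H.
  replace (u * B * ((C ^ 2 + B ^ 2 - d y p ^ 2) / (C * B))) with (u * w) in H.
  2: { unfold w. rewrite (metric_sym X d Hm y p). field. lra. }
  specialize (Hmin u ltac:(lra)). rewrite (metric_sym X d Hm p) in Hmin.
  assert (B ^ 2 <= d (f u) p ^ 2) by (apply pow_incr; lra). nra.
Qed.

(** [q] is the projection of [p] to the side. The obtuse angles at [q] force comparison angles at
    most pi/2 at [p], which is [cat0_chord] with [kappa = 2]. *)
Lemma far_side p y z s N :
  geodesic_seg X d y z s -> 0 <= N -> (forall q, on_seg X d y z s q -> N < d p q) ->
  exists q, N < d p q /\
    forall fy fq fz, geodesic_seg X d p y fy -> geodesic_seg X d p q fq ->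
      geodesic_seg X d p z fz -> forall t, 0 <= t <= N ->
      d (fy t) (fq t) ^ 2 <= 2 * t ^ 2 /\ d (fq t) (fz t) ^ 2 <= 2 * t ^ 2.
Proof.
  intros Hs HN Hfar. destruct (closest_point p y z s Hs) as [t0 [Ht0 Hmin]].
  pose proof (metric_nonneg X d Hm y z) as H0.
  assert (Hq : N < d p (s t0)) by (apply Hfar; exists t0; auto).
  assert (Hy : N < d p y).
  { apply Hfar. exists 0. split; [lra|]. symmetry. apply Hs. }
  assert (Hz : N < d p z).
  { apply Hfar. exists (d y z). split; [lra|]. symmetry. apply Hs. }
  exists (s t0). split; [exact Hq|]. intros fy fq fz Hfy Hfq Hfz t Ht.
  assert (Oy : d p (s t0) ^ 2 + d (s t0) y ^ 2 <= d p y ^ 2).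
  { apply (foot_angle_obtuse p (s t0) y (fun u => s (t0 - u))); [|  |lra].
    - apply (geodesic_seg_prefix_rev X d Hm y z); assumption.
    - intros u Hu. apply Hmin. rewrite (metric_sym X d Hm (s t0)) in Hu.
      rewrite (geodesic_seg_dist_left X d y z) in Hu by assumption. lra. }
  assert (Oz : d p (s t0) ^ 2 + d (s t0) z ^ 2 <= d p z ^ 2).
  { apply (foot_angle_obtuse p (s t0) z (fun u => s (t0 + u))); [|  |lra].
    - apply (geodesic_seg_suffix X d y z); assumption.
    - intros u Hu. apply Hmin.
      rewrite (geodesic_seg_dist_right X d y z) in Hu by assumption. lra. }
  pose proof (pow2_ge_0 (d p (s t0))).
  split.
  - apply (cat0_chord p y (s t0)); try assumption; try lra.
    rewrite (metric_sym X d Hm y). lra.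
  - apply (cat0_chord p (s t0) z); try assumption; lra.
Qed.

End LimitRays.

(** * Series dominated by a dyadic geometric series *)

Section DyadicSeries.
Variables (a : nat -> R) (b : R).
Hypothesis Ha : forall n, 0 <= a n <= b / 2 ^ S n.

Lemma is_series_dyadic : is_series (fun n => b / 2 ^ S n) b.
Proof.
  assert (H : is_series (fun n => (b / 2) * (/ 2) ^ n) ((b / 2) * / (1 - / 2))).
  { apply @is_series_scal. apply is_series_geom. rewrite Rabs_right; lra. }
  replace (b / 2 * / (1 - / 2)) with b in H by field.
  apply is_series_ext with (2 := H). intros n. simpl. rewrite pow_inv. field.
  apply pow_nonzero. lra.
Qed.

Lemma ex_series_dyadic : ex_series a.
Proof.
  apply (@ex_series_le R_AbsRing R_CompleteNormedModule _ (fun n => b / 2 ^ S n)).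
  - intros n. unfold norm; simpl. unfold abs; simpl. rewrite Rabs_right; [apply Ha | apply Rle_ge, Ha].
  - exists b. apply is_series_dyadic.
Qed.

Lemma Series_dyadic_le : Series a <= b.
Proof.
  rewrite <- (is_series_unique _ _ is_series_dyadic). apply Series_le; [exact Ha|].
  exists b. apply is_series_dyadic.
Qed.

Lemma Series_dyadic_ge0 : 0 <= Series a.
Proof.
  rewrite <- (Rmult_0_l (Series a)), <- Series_scal_l.
  apply Series_le; [|apply ex_series_dyadic].
  intros n. specialize (Ha n). lra.
Qed.

End DyadicSeries.

Lemma dyadic_shift a b : (forall n, 0 <= a n <= b / 2 ^ S n) ->
  forall n, 0 <= a (S n) <= (b / 2) / 2 ^ S n.
Proof.
  intros Ha n. specialize (Ha (S n)).
  replace (b / 2 / 2 ^ S n) with (b / 2 ^ S (S n)); [exact Ha|].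
  simpl. field. apply pow_nonzero. lra.
Qed.

(** The first [N] terms are bounded by [C], the tail by the geometric series; each shift of the
    sequence halves [b]. *)
Lemma Series_dyadic_split N : forall a b C,
  (forall n, 0 <= a n <= b / 2 ^ S n) -> (forall n, (n < N)%nat -> a n <= C) ->
  Series a <= INR N * C + b / 2 ^ N.
Proof.
  induction N as [|N IH]; intros a b C Ha HC.
  - simpl. pose proof (Series_dyadic_le a b Ha). lra.
  - rewrite Series_incr_1 by (apply (ex_series_dyadic a b Ha)).
    pose proof (IH (fun n => a (S n)) (b / 2) C (dyadic_shift a b Ha)) as H.
    specialize (H ltac:(intros n Hn; apply HC; lia)).
    specialize (HC 0%nat ltac:(lia)). rewrite S_INR.
    replace (b / 2 ^ S N) with (b / 2 / 2 ^ N); [lra|].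
    simpl. field. apply pow_nonzero. lra.
Qed.

Lemma Series_dyadic_ge_term N : forall a b,
  (forall n, 0 <= a n <= b / 2 ^ S n) -> a N <= Series a.
Proof.
  induction N as [|N IH]; intros a b Ha;
    rewrite Series_incr_1 by (apply (ex_series_dyadic a b Ha)).
  - pose proof (Series_dyadic_ge0 _ _ (dyadic_shift a b Ha)). lra.
  - pose proof (IH (fun n => a (S n)) (b / 2) (dyadic_shift a b Ha)). specialize (Ha 0%nat). lra.
Qed.

Lemma pow2_gt_INR n : INR n < 2 ^ n.
Proof.
  induction n as [|n IH]; [simpl; lra|]. rewrite S_INR. simpl.
  pose proof (pow_R1_Rle 2 n ltac:(lra)). lra.
Qed.

Lemma inv_pow2_lt_exists e : 0 < e -> exists n, / 2 ^ n < e.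
Proof.
  intros He. destruct (INR_unbounded (/ e)) as [n Hn]. exists n.
  rewrite <- (Rinv_inv e). apply Rinv_lt_contravar.
  - apply Rmult_lt_0_compat; [apply Rinv_0_lt_compat, He | apply pow_lt; lra].
  - pose proof (pow2_gt_INR n). lra.
Qed.

(** * Estimates for the boundary distance *)

Section BoundaryDistance.
Variables (X : Type) (d : X -> X -> R).
Hypothesis Hm : is_metric X d.

Lemma dbd_terms (a b : R -> X) n :
  0 <= Rmin (d (a (INR (S n))) (b (INR (S n)))) (/ 2 ^ S n) <= 1 / 2 ^ S n.
Proof.
  assert (0 < / 2 ^ S n) by (apply Rinv_0_lt_compat, pow_lt; lra).
  split.
  - apply Rmin_glb; [apply metric_nonneg, Hm | lra].
  - unfold Rdiv. rewrite Rmult_1_l. apply Rmin_r.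
Qed.

Lemma dbd_small c : 0 < c -> exists eps, 0 < eps /\
  forall a b, (forall s, 0 <= s -> d (a s) (b s) <= eps * s) -> dbd X d a b <= c.
Proof.
  intros Hc. destruct (inv_pow2_lt_exists (c / 2) ltac:(lra)) as [N HN].
  set (M := INR N). assert (HM : 0 <= M) by apply pos_INR.
  assert (HM2 : 0 < 2 * (M * M) + 1) by nra.
  (* The first [N] terms are at most [eps * M] each, so this [eps] keeps their sum below [c / 2];
     the summand 1 covers [M = 0]. *)
  exists (c / (2 * (M * M) + 1)). assert (He : 0 < c / (2 * (M * M) + 1)) by (apply Rdiv_lt_0_compat; lra).
  split; [exact He|]. set (eps := c / (2 * (M * M) + 1)) in *.
  intros a b Hab.
  pose proof (Series_dyadic_split N _ 1 (eps * M) (dbd_terms a b)) as H.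
  assert (HC : eps * (2 * (M * M) + 1) = c) by (unfold eps; field; lra).
  unfold dbd. eapply Rle_trans; [apply H|].
  - intros n Hn. eapply Rle_trans; [apply Rmin_l|]. eapply Rle_trans; [apply Hab, pos_INR|].
    apply Rmult_le_compat_l; [lra|]. apply le_INR. lia.
  - fold M. unfold Rdiv. rewrite Rmult_1_l. nra.
Qed.

Lemma dbd_ge a b n :
  1 <= d (a (INR (S n))) (b (INR (S n))) -> / 2 ^ S n <= dbd X d a b.
Proof.
  intros H. unfold dbd.
  pose proof (Series_dyadic_ge_term n _ 1 (dbd_terms a b)) as H1. cbv beta in H1.
  rewrite Rmin_right in H1; [exact H1|]. apply Rle_trans with (2 := H).
  rewrite <- Rinv_1. apply Rinv_le_contravar; [lra|]. apply pow_R1_Rle. lra.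
Qed.

(** By [ray_ratio_mono], [d (ra s) (rb s) / s] is at most [eps + K / t] for every large [t]. Hence a
    linear bound passes to the representatives from [x], with the same [eps] for all translates. *)
Lemma asymptotic_chord_transfer (Hcat : CAT0 X d) x a b ra rb eps :
  ray_from X d x ra -> ray_from X d x rb ->
  asymptotic X d ra a -> asymptotic X d rb b ->
  (forall s, 0 <= s -> d (a s) (b s) <= eps * s) ->
  forall s, 0 <= s -> d (ra s) (rb s) <= eps * s.
Proof.
  intros Hra Hrb [K1 H1] [K2 H2] Hab s Hs. apply Rnot_lt_le. intros Hlt.
  set (e := d (ra s) (rb s) - eps * s). assert (He : 0 < e) by (unfold e; lra).
  set (K := K1 + K2).
  assert (HK : 0 <= K).
  { specialize (H1 0 (Rle_refl 0)). specialize (H2 0 (Rle_refl 0)). unfold K.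
    pose proof (metric_nonneg X d Hm (ra 0) (a 0)).
    pose proof (metric_nonneg X d Hm (rb 0) (b 0)). lra. }
  (* Chosen so that [e * t > s * K]. *)
  set (t := s * K / e + s + 1).
  assert (Ht : s + 1 <= t).
  { unfold t. assert (0 <= s * K / e) by (apply Rdiv_le_0_compat; nra). lra. }
  pose proof (ray_ratio_mono X d Hm Hcat x ra rb s t Hra Hrb ltac:(lra) ltac:(lra)) as H.
  assert (Hd : d (ra t) (rb t) <= K + eps * t).
  { specialize (H1 t ltac:(lra)). specialize (H2 t ltac:(lra)). specialize (Hab t ltac:(lra)).
    pose proof (metric_tri X d Hm (ra t) (a t) (rb t)).
    pose proof (metric_tri X d Hm (a t) (b t) (rb t)).
    rewrite (metric_sym X d Hm (b t)) in *. unfold K. lra. }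
  assert (H3 : d (ra s) (rb s) * t <= s * (K + eps * t)).
  { apply Rle_trans with (s / t * d (ra t) (rb t) * t); [apply Rmult_le_compat_r; lra|].
    replace (s / t * d (ra t) (rb t) * t) with (s * d (ra t) (rb t)) by (field; lra).
    apply Rmult_le_compat_l; lra. }
  assert (H4 : e * t = s * K + e * (s + 1)) by (unfold t; field; lra).
  unfold e in *. nra.
Qed.

End BoundaryDistance.

(** * Failure of hyperbolicity gives distinct boundary points at small angle *)

Section SmallChords.
Variables (X : Type) (d : X -> X -> R).
Hypothesis Hm : is_metric X d.
Hypothesis Hcat : CAT0 X d.
Variables (G : Type) (mul : G -> G -> G) (one : G) (inv : G -> G) (act : G -> X -> X).
Hypothesis HG : is_group G mul one inv.
Hypothesis Hact : geometric_action X d G mul one act.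

Lemma act_geodesic_seg g x y s :
  geodesic_seg X d x y s -> geodesic_seg X d (act g x) (act g y) (fun t => act g (s t)).
Proof.
  pose proof (act_isometry X d G mul one act Hact) as Hi.
  intros [H0 [H1 H2]]. unfold geodesic_seg. rewrite Hi, H0, H1.
  split; [reflexivity|split; [reflexivity|]]. intros t u Ht Hu. rewrite Hi. apply H2; assumption.
Qed.

Lemma act_geodesic_ray g r : geodesic_ray X d r -> geodesic_ray X d (fun t => act g (r t)).
Proof.
  intros Hr t u Ht Hu. rewrite (act_isometry X d G mul one act Hact). apply Hr; assumption.
Qed.

Lemma act_asymptotic g r s :
  asymptotic X d r s -> asymptotic X d (fun t => act g (r t)) (fun t => act g (s t)).
Proof.
  intros [K HK]. exists K. intros t Ht. rewrite (act_isometry X d G mul one act Hact). apply HK, Ht.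
Qed.

(* [e 0], [e 2], [e 4] are the vertices x, z, y of a fat triangle, [p] lies on its
   side xy, and [e 1], [e 3] are the projections of [p] to zx and yz. *)
Lemma fat_triangle_fan x0 D N :
  ~ hyperbolic X d -> (forall x, exists g, d (act g x) x0 < D) -> 0 < N ->
  exists (p : X) (e : nat -> X) (f : nat -> R -> X),
    d p x0 < D /\
    (forall i, geodesic_seg X d p (e i) (f i) /\ N < d p (e i)) /\
    (forall i t, (i < 4)%nat -> 0 <= t <= N -> d (f i t) (f (S i) t) ^ 2 <= 2 * t ^ 2) /\
    (forall t, 0 <= t <= N -> d (f 0%nat t) (f 4%nat t) = 2 * t).
Proof.
  intros Hnh HD HN.
  assert (HT : exists x y z sxy syz szx p,
    geodesic_seg X d x y sxy /\ geodesic_seg X d y z syz /\ geodesic_seg X d z x szx /\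
    on_seg X d x y sxy p /\
    forall q, on_seg X d y z syz q \/ on_seg X d z x szx q -> N < d p q).
  { apply NNPP. intros HT. apply Hnh. split; [apply Hcat|]. exists N. split; [exact HN|].
    intros x y z sxy syz szx H1 H2 H3 p Hp. apply NNPP. intros Hq. apply HT.
    exists x, y, z, sxy, syz, szx, p. do 4 (split; [assumption|]).
    intros q Hq'. apply Rnot_le_lt. intros Hle. apply Hq. exists q. split; [exact Hq'|exact Hle]. }
  assert (HT' : exists x y z sxy syz szx p,
    geodesic_seg X d x y sxy /\ geodesic_seg X d y z syz /\ geodesic_seg X d z x szx /\
    on_seg X d x y sxy p /\ d p x0 < D /\
    forall q, on_seg X d y z syz q \/ on_seg X d z x szx q -> N < d p q).
  (* Translating the fat triangle brings [p] within [D] of [x0], which lets the points [p] of a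
     sequence of triangles converge. *)
  { destruct HT as [x [y [z [sxy [syz [szx [p [H1 [H2 [H3 [[t [Ht ->]] Hfar]]]]]]]]]]].
    destruct (HD (sxy t)) as [g Hg].
    pose proof (act_isometry X d G mul one act Hact g) as Hi.
    exists (act g x), (act g y), (act g z), (fun t => act g (sxy t)),
      (fun t => act g (syz t)), (fun t => act g (szx t)), (act g (sxy t)).
    do 3 (split; [apply act_geodesic_seg; assumption|]).
    split; [exists t; rewrite Hi; auto|]. split; [exact Hg|].
    intros q [[u [Hu ->]]|[u [Hu ->]]]; rewrite Hi in *; apply Hfar; [left|right]; exists u; auto. }
  clear HT Hnh HD.
  destruct HT' as [x [y [z [sxy [syz [szx [p [H1 [H2 [H3 [[t0 [Ht0 ->]] [Hp Hfar]]]]]]]]]]]].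
  set (p := sxy t0) in *.
  destruct (far_side X d Hm Hcat p _ _ _ N H2 ltac:(lra)) as [q1 [Hq1 F1]];
    [intros q Hq; apply Hfar; auto|].
  destruct (far_side X d Hm Hcat p _ _ _ N H3 ltac:(lra)) as [q2 [Hq2 F2]];
    [intros q Hq; apply Hfar; auto|].
  assert (Hz : N < d p z).
  { apply Hfar. right. exists 0. pose proof (metric_nonneg X d Hm z x).
    split; [lra|]. symmetry. apply H3. }
  assert (Hy : N < d p y).
  { apply Hfar. left. exists 0. pose proof (metric_nonneg X d Hm y z).
    split; [lra|]. symmetry. apply H2. }
  assert (Hx : N < d p x).
  { apply Hfar. right. exists (d z x). pose proof (metric_nonneg X d Hm z x).
    split; [lra|]. symmetry. apply H3. }
  destruct (proj1 Hcat p q1) as [f1 Hf1]. destruct (proj1 Hcat p q2) as [f2 Hf2].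
  destruct (proj1 Hcat p z) as [fz Hfz].
  pose proof (geodesic_seg_prefix_rev X d Hm _ _ _ _ H1 Ht0) as Hfx.
  pose proof (geodesic_seg_suffix X d _ _ _ _ H1 Ht0) as Hfy.
  fold p in Hfx, Hfy.
  exists p, (fun i => match i with 0 => x | 1 => q2 | 2 => z | 3 => q1 | _ => y end)%nat,
    (fun i => match i with 0 => (fun t => sxy (t0 - t)%R) | 1 => f2 | 2 => fz | 3 => f1
              | _ => (fun t => sxy (t0 + t)%R) end)%nat.
  split; [exact Hp|]. split; [|split].
  - intros [|[|[|[|i]]]]; auto.
  - intros i t Hi Ht.
    destruct (F1 _ _ _ Hfy Hf1 Hfz t Ht) as [E1 E2].
    destruct (F2 _ _ _ Hfz Hf2 Hfx t Ht) as [E3 E4].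
    destruct i as [|[|[|[|i]]]]; [| | | |lia]; rewrite (metric_sym X d Hm); assumption.
  - intros t Ht. assert (Dx : d p x = t0).
    { rewrite (metric_sym X d Hm). apply (geodesic_seg_dist_left X d x y); assumption. }
    assert (Dy : d p y = d x y - t0) by (apply geodesic_seg_dist_right; assumption).
    rewrite (geodesic_seg_dist X d x y) by (try assumption; lra).
    rewrite Rabs_left1; lra.
Qed.

(** The fans of ever fatter triangles converge to five rays [r 0], ..., [r 4]. Were all consecutive
    pairs asymptotic, so would be [r 0] and [r 4], which are at distance at least [2 * t] at time
    [t]. *)
Lemma right_angled_rays U (HU : free_ultrafilter U) :
  bounded_ulims U X d -> X -> ~ hyperbolic X d ->
  exists o a b, ray_from X d o a /\ ray_from X d o b /\ ~ asymptotic X d a b /\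
    chord_le X d 2 a b.
Proof.
  intros HL x0 Hnh.
  destruct (cocompact_bound X d Hm G mul one inv act HG Hact x0) as [D [_ HD]].
  (* [INR n + 1] keeps the fatness positive at [n = 0]. *)
  destruct (choice (fun n (F : X * (nat -> X) * (nat -> R -> X)) =>
      let '(p, e, f) := F in let N := (INR n + 1)%R in
      d p x0 < D /\
      (forall i, geodesic_seg X d p (e i) (f i) /\ N < d p (e i)) /\
      (forall i t, (i < 4)%nat -> 0 <= t <= N -> d (f i t) (f (S i) t) ^ 2 <= 2 * t ^ 2) /\
      (forall t, 0 <= t <= N -> d (f 0%nat t) (f 4%nat t) = 2 * t))) as [F HF].
  { intros n. pose proof (pos_INR n).
    destruct (fat_triangle_fan x0 D (INR n + 1) Hnh HD ltac:(lra)) as [p [e [f Hf]]].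
    exists (p, e, f). exact Hf. }
  set (p := fun n => fst (fst (F n))). set (e := fun n => snd (fst (F n))).
  set (f := fun n => snd (F n)).
  assert (HF' : forall n, d (p n) x0 < D /\
      (forall i, geodesic_seg X d (p n) (e n i) (f n i) /\ INR n + 1 < d (p n) (e n i)) /\
      (forall i t, (i < 4)%nat -> 0 <= t <= INR n + 1 ->
         d (f n i t) (f n (S i) t) ^ 2 <= 2 * t ^ 2) /\
      (forall t, 0 <= t <= INR n + 1 -> d (f n 0%nat t) (f n 4%nat t) = 2 * t)).
  { intros n. specialize (HF n). unfold p, e, f. destruct (F n) as [[p' e'] f']. exact HF. }
  destruct (HL x0 D p) as [o Ho].
  { apply uf_all; [exact HU|]. intros n. rewrite (metric_sym X d Hm).
    destruct (HF' n) as [H _]. lra. }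
  destruct (choice (fun i r => ray_from X d o r /\
      forall t, 0 <= t -> ulim U X d (fun n => f n i t) (r t))) as [r Hr].
  { intros i. apply (limit_ray X d Hm U HU HL o p (fun n => e n i)).
    - exact Ho.
    - intros n. apply (HF' n).
    - intros t. apply (uf_mono U HU) with (2 := uf_INR U HU t). intros n Hn.
      destruct (HF' n) as [_ [H _]]. specialize (H i). lra. }
  assert (Hstep : forall i, (i < 4)%nat -> chord_le X d 2 (r i) (r (S i))).
  { intros i Hi t Ht.
    apply (ulim_sqr_dist_le X d Hm U HU _ _ _ _ _ (proj2 (Hr i) t Ht) (proj2 (Hr (S i)) t Ht)).
    apply (uf_mono U HU) with (2 := uf_INR U HU t). intros n Hn.
    apply (HF' n); [exact Hi | lra]. }
  assert (Hopp : ~ asymptotic X d (r 0%nat) (r 4%nat)).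
  { intros [K HK]. assert (HK0 : 0 <= K + 1).
    { specialize (HK 0 (Rle_refl 0)). pose proof (metric_nonneg X d Hm (r 0%nat 0) (r 4%nat 0)). lra. }
    specialize (HK _ HK0).
    assert (2 * (K + 1) <= d (r 0%nat (K + 1)) (r 4%nat (K + 1))); [|lra].
    apply (ulim_dist_ge X d Hm U HU _ _ _ _ _ (proj2 (Hr 0%nat) _ HK0) (proj2 (Hr 4%nat) _ HK0)).
    apply (uf_mono U HU) with (2 := uf_INR U HU (K + 1)). intros n Hn.
    apply Req_le. symmetry. apply (HF' n). lra. }
  apply NNPP. intros HN. apply Hopp.
  assert (Has : forall i, (i < 4)%nat -> asymptotic X d (r i) (r (S i))).
  { intros i Hi. apply NNPP. intros Hna. apply HN. exists o, (r i), (r (S i)).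
    split; [apply Hr|]. split; [apply Hr|]. auto. }
  apply (asymptotic_trans X d Hm _ (r 1%nat)); [apply Has; lia|].
  apply (asymptotic_trans X d Hm _ (r 2%nat)); [apply Has; lia|].
  apply (asymptotic_trans X d Hm _ (r 3%nat)); apply Has; lia.
Qed.

Lemma small_chord_rays eps : X -> ~ hyperbolic X d -> 0 < eps ->
  exists o a b, ray_from X d o a /\ ray_from X d o b /\ ~ asymptotic X d a b /\
    forall s, 0 <= s -> d (a s) (b s) <= eps * s.
Proof.
  intros x0 Hnh He. destruct free_ultrafilter_exists as [U HU].
  pose proof (geometric_bounded_ulims X d Hm (proj1 Hcat) G mul one inv act HG Hact U HU) as HL.
  destruct (right_angled_rays U HU HL x0 Hnh) as [o [a0 [b0 [Ha0 [Hb0 [Hn0 Hc0]]]]]].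
  assert (Hj : forall j, exists a b, ray_from X d o a /\ ray_from X d o b /\
    ~ asymptotic X d a b /\ chord_le X d (2 / 2 ^ j) a b).
  { induction j as [|j [a [b [Ha [Hb [Hn Hc]]]]]].
    - exists a0, b0. simpl. rewrite Rdiv_1_r. auto.
    - pose proof (pow_R1_Rle 2 j ltac:(lra)) as Hp.
      assert (H2 : 0 <= 2 / 2 ^ j <= 2).
      { split; [apply Rdiv_le_0_compat; lra|]. apply Rmult_le_reg_r with (2 ^ j); [lra|].
        unfold Rdiv. rewrite Rmult_assoc, Rinv_l; lra. }
      replace (2 / 2 ^ S j) with (2 / 2 ^ j / 2) by (simpl; field; lra).
      apply (halve_chord X d Hm Hcat U HU HL o a b); assumption. }
  (* After [j] halvings of 2 the squared chord is at most [2 / 2 ^ j * s ^ 2], so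
     [2 / 2 ^ j <= eps ^ 2] is what is required. *)
  destruct (inv_pow2_lt_exists (eps ^ 2 / 2)) as [j Hjlt]; [nra|].
  destruct (Hj j) as [a [b [Ha [Hb [Hn Hc]]]]].
  exists o, a, b. do 3 (split; [assumption|]). intros s Hs.
  apply Rsqr_incr_0_var; [|nra]. unfold Rsqr. specialize (Hc s Hs).
  assert (2 / 2 ^ j <= eps ^ 2) by (unfold Rdiv; lra).
  pose proof (pow2_ge_0 s). nra.
Qed.

End SmallChords.

(** * Hyperbolicity and the spread of translates; the two implications *)

Section HyperbolicSpread.
Variables (X : Type) (d : X -> X -> R).
Hypothesis Hm : is_metric X d.
Hypothesis Hcat : CAT0 X d.

(** Both rays start at [o], so [u] and [T] differ by at most [delta] and
    [d (a T) (b T) <= 2 * delta], against monotonicity. This excludes one side of a slim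
    triangle. *)
Lemma rays_diverge_from o a b delta T0 T u :
  ray_from X d o a -> ray_from X d o b -> 0 <= T0 <= T -> 0 <= u ->
  2 * delta < d (a T0) (b T0) -> d (a T) (b u) <= delta -> False.
Proof.
  intros Ha Hb HT Hu Hfar Hle.
  assert (Hmono : d (a T0) (b T0) <= d (a T) (b T)).
  { destruct (Rle_lt_or_eq_dec 0 T ltac:(lra)) as [H0|H0].
    2: { replace T0 with T by lra. lra. }
    eapply Rle_trans; [apply (ray_ratio_mono X d Hm Hcat o a b T0 T); try assumption; lra|].
    assert (T0 / T <= 1).
    { apply Rmult_le_reg_r with T; [lra|]. unfold Rdiv. rewrite Rmult_assoc, Rinv_l; lra. }
    pose proof (metric_nonneg X d Hm (a T) (b T)). nra. }
  destruct Ha as [Ha Ha0]. destruct Hb as [Hb Hb0].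
  pose proof (ray_dist0 X d a T Ha ltac:(lra)) as E1. rewrite Ha0 in E1.
  pose proof (ray_dist0 X d b u Hb Hu) as E2. rewrite Hb0 in E2.
  pose proof (metric_tri X d Hm o (b u) (a T)) as T1.
  pose proof (metric_tri X d Hm o (a T) (b u)) as T2.
  pose proof (metric_tri X d Hm (a T) (b u) (b T)) as T3.
  rewrite (metric_sym X d Hm (b u) (a T)) in T1. rewrite (Hb u T Hu) in T3 by lra.
  assert (Rabs (u - T) <= delta) by (apply Rabs_le; lra). lra.
Qed.

(** [q] lies between [y] and [z], so [d y z] is at least [d x y + d x z - 2 * d x q]; compare with
    the path from [y] to [z] through [fy s] and [fz s]. *)
Lemma endpoints_spread x y z q fy fz s :
  geodesic_seg X d x y fy -> geodesic_seg X d x z fz ->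
  d y q + d q z = d y z -> 0 <= s <= d x y -> s <= d x z ->
  2 * s - 2 * d x q <= d (fy s) (fz s).
Proof.
  intros Hy Hz Hq Hs1 Hs2.
  pose proof (geodesic_seg_dist_right X d _ _ _ _ Hy Hs1) as E1.
  pose proof (geodesic_seg_dist_right X d _ _ _ s Hz ltac:(lra)) as E2.
  pose proof (metric_tri X d Hm x q y) as T1. pose proof (metric_tri X d Hm x q z) as T2.
  pose proof (metric_tri X d Hm y (fy s) z) as T3.
  pose proof (metric_tri X d Hm (fy s) (fz s) z) as T4.
  rewrite (metric_sym X d Hm y (fy s)) in T3. rewrite (metric_sym X d Hm q y) in T1. lra.
Qed.

Variables (G : Type) (mul : G -> G -> G) (one : G) (inv : G -> G) (act : G -> X -> X).
Hypothesis HG : is_group G mul one inv.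
Hypothesis Hact : geometric_action X d G mul one act.

Lemma hyperbolic_limsup x0 : hyperbolic X d ->
  exists c, 0 < c /\ forall a b, geodesic_ray X d a -> geodesic_ray X d b ->
    ~ asymptotic X d a b -> limsup_gt G (dbd_translate_gt X d G act x0 a b) c.
Proof.
  intros [_ [delta [Hdel Hslim]]].
  destruct free_ultrafilter_exists as [U HU].
  pose proof (geometric_bounded_ulims X d Hm (proj1 Hcat) G mul one inv act HG Hact U HU) as HL.
  pose proof (act_isometry X d G mul one act Hact) as Hi.
  destruct (cocompact_bound X d Hm G mul one inv act HG Hact x0) as [D [HD0 HD]].
  (* The translated side passes within [D + delta] of [x0], so at time [N + 1] the rays are at least
     1 apart and the term of index [N] gives [w]. The values [w / 4 < w / 2 < w] leave room for the
     strict inequalities. *)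
  destruct (INR_unbounded (D + delta + 1)) as [N HN].
  set (w := / 2 ^ S N). assert (Hw : 0 < w) by (apply Rinv_0_lt_compat, pow_lt; lra).
  exists (w / 4). split; [lra|]. intros a b Ha Hb Hab.
  exists (w / 2). split; [lra|]. intros F.
  (* [b] is replaced by an asymptotic ray from [a 0], so that both rays are sides of one
     triangle. *)
  destruct (ray_from_exists X d Hm Hcat U HU HL (a 0) b Hb) as [b' [Hb' Hbb]].
  assert (Hab' : ~ asymptotic X d a b').
  { intros H. apply Hab. apply (asymptotic_trans X d Hm _ _ _ H Hbb). }
  assert (HT0 : exists T0, 0 <= T0 /\ 2 * delta < d (a T0) (b' T0)).
  { apply NNPP. intros H. apply Hab'. exists (2 * delta). intros t Ht.
    apply Rnot_lt_le. intros Hlt. apply H. exists t. auto. }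
  destruct HT0 as [T0 [HT0 Hfar]].
  assert (HM : exists M, 0 <= M /\ forall g, In g F -> d (act g (a 0)) x0 <= M).
  { induction F as [|h F [M [HM0 HM]]].
    - exists 0. split; [lra|]. intros g [].
    - exists (Rmax M (d (act h (a 0)) x0)).
      pose proof (Rmax_l M (d (act h (a 0)) x0)). pose proof (Rmax_r M (d (act h (a 0)) x0)).
      split; [lra|]. intros g [<-|Hg]; [lra|]. specialize (HM g Hg). lra. }
  destruct HM as [M [HM0 HM]].
  (* [T >= T0] is past the divergence time, and [T >= D + M] keeps [g] out of [F]: an element of [F]
     moves [a 0] at most [M] from [x0]. *)
  set (T := T0 + D + M). destruct (HD (a T)) as [g Hg].
  exists g. split.
  { intros HgF. specialize (HM g HgF).
    pose proof (metric_tri X d Hm (act g (a 0)) x0 (act g (a T))) as H.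
    rewrite Hi, (ray_dist0 X d a T Ha), (metric_sym X d Hm x0) in H; unfold T in *; lra. }
  destruct (choice (fun n s => geodesic_seg X d x0 (act g (a (INR n))) s)
    (fun n => proj1 Hcat _ _)) as [f Hf].
  destruct (choice (fun n s => geodesic_seg X d x0 (act g (b' (INR n))) s)
    (fun n => proj1 Hcat _ _)) as [h Hh].
  destruct (limit_ray_asymptotic X d Hm Hcat U HU HL x0 _ f
    (act_geodesic_ray X d G mul one act Hact g a Ha) Hf) as [ra [Hra [Hasa Hlima]]].
  destruct (limit_ray_asymptotic X d Hm Hcat U HU HL x0 _ h
    (act_geodesic_ray X d G mul one act Hact g b' (proj1 Hb')) Hh) as [rb [Hrb [Hasb Hlimb]]].
  exists ra, rb. do 3 (split; [assumption|]). split.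
  { apply (asymptotic_trans X d Hm _ _ _ Hasb).
    apply (act_asymptotic X d G mul one act Hact), Hbb. }
  apply Rlt_le_trans with w; [lra|]. apply dbd_ge; [exact Hm|].
  set (s := INR (S N)). assert (Hs : D + delta + 1 < s) by (unfold s; rewrite S_INR; lra).
  apply (ulim_dist_ge X d Hm U HU _ _ _ _ _ (Hlima s ltac:(lra)) (Hlimb s ltac:(lra))).
  (* The first bound on [n] puts [a T] on the side from [a 0] to [a (INR n)]; the second makes both
     segments from [x0] at least [s] long. *)
  apply (uf_mono U HU) with (2 := uf_and U HU _ _ (uf_INR U HU T)
    (uf_INR U HU (s + d x0 (act g (a 0))))).
  intros n [Hn1 Hn2].
  assert (Hin : forall r, geodesic_ray X d r -> r 0 = a 0 -> s <= d x0 (act g (r (INR n)))).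
  { intros r Hr Hr0. pose proof (metric_tri X d Hm (act g (r 0)) x0 (act g (r (INR n)))) as H.
    rewrite Hi, (ray_dist0 X d r _ Hr (pos_INR n)), Hr0, (metric_sym X d Hm _ x0) in H. lra. }
  assert (Hq : exists q, d (a (INR n)) q + d q (b' (INR n)) = d (a (INR n)) (b' (INR n)) /\
    d (a T) q <= delta).
  { destruct (proj1 Hcat (a (INR n)) (b' (INR n))) as [sg Hsg].
    pose proof (ray_seg X d a _ Ha (pos_INR n)) as Sa.
    pose proof (ray_seg X d b' _ (proj1 Hb') (pos_INR n)) as Sb.
    apply (geodesic_seg_rev X d Hm) in Sb.
    pose proof (ray_dist0 X d b' _ (proj1 Hb') (pos_INR n)) as Lb.
    rewrite (proj2 Hb') in Sb, Lb.
    destruct (Hslim _ _ _ _ _ _ Sa Hsg Sb (a T)) as [q [[[t [Ht ->]]|[t [Ht ->]]] Hqd]].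
    - exists T. split; [|reflexivity]. rewrite (ray_dist0 X d a _ Ha (pos_INR n)).
      unfold T in *. lra.
    - exists (sg t). split; [|exact Hqd].
      rewrite (geodesic_seg_dist_left X d _ _ _ _ Hsg Ht).
      rewrite (geodesic_seg_dist_right X d _ _ _ _ Hsg Ht). lra.
    - exfalso. rewrite (metric_sym X d Hm (b' (INR n))), Lb in Ht.
      refine (rays_diverge_from (a 0) a b' delta T0 T _ (conj Ha eq_refl) Hb' _ _ Hfar Hqd).
      + unfold T. lra.
      + rewrite Lb. lra. }
  destruct Hq as [q [Hq1 Hq2]].
  pose proof (endpoints_spread x0 _ _ (act g q) _ _ s (Hf n) (Hh n)) as H.
  rewrite !Hi in H. specialize (H Hq1).
  assert (Hs0 : 0 <= s) by lra.
  specialize (H (conj Hs0 (Hin a Ha eq_refl)) (Hin b' (proj1 Hb') (proj2 Hb'))).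
  pose proof (metric_tri X d Hm x0 (act g (a T)) (act g q)) as H1.
  rewrite Hi, (metric_sym X d Hm x0 (act g (a T))) in H1. lra.
Qed.

Lemma limsup_hyperbolic x0 c : 0 < c ->
  (forall a b, geodesic_ray X d a -> geodesic_ray X d b ->
    ~ asymptotic X d a b -> limsup_gt G (dbd_translate_gt X d G act x0 a b) c) ->
  hyperbolic X d.
Proof.
  intros Hc Hlim. apply NNPP. intros Hnh.
  destruct (dbd_small X d Hm c Hc) as [eps [He Hsmall]].
  destruct (small_chord_rays X d Hm Hcat G mul one inv act HG Hact eps x0 Hnh He)
    as [o [a [b [Ha [Hb [Hab Hch]]]]]].
  destruct (Hlim a b (proj1 Ha) (proj1 Hb) Hab) as [c' [Hc' HF]].
  (* The empty list already gives a translate with boundary distance above [c], against the uniform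
     bound on translates. *)
  destruct (HF nil) as [g [_ [ra [rb [Hra [Hrb [Hasa [Hasb Hgt]]]]]]]].
  assert (Hle : dbd X d ra rb <= c); [|lra].
  apply Hsmall. apply (asymptotic_chord_transfer X d Hm Hcat x0 _ _ _ _ eps Hra Hrb Hasa Hasb).
  intros s Hs. rewrite (act_isometry X d G mul one act Hact). apply Hch, Hs.
Qed.

End HyperbolicSpread.

Theorem theorem4p3 (X : Type) (d : X -> X -> R) (x0 : X)
  (G : Type) (mul : G -> G -> G) (one : G) (inv : G -> G) (act : G -> X -> X) :
  is_metric X d -> CAT0 X d ->
  is_group G mul one inv ->
  geometric_action X d G mul one act ->
  boundary_gt2 X d ->
  (hyperbolic X d <->
   exists c, 0 < c /\
     forall a b : R -> X, geodesic_ray X d a -> geodesic_ray X d b ->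
       ~ asymptotic X d a b ->
       limsup_gt G (dbd_translate_gt X d G act x0 a b) c).
Proof.
  intros Hm Hcat HG Hact _. split.
  - exact (hyperbolic_limsup X d Hm Hcat G mul one inv act HG Hact x0).
  - intros [c [Hc Hlim]].
    exact (limsup_hyperbolic X d Hm Hcat G mul one inv act HG Hact x0 c Hc Hlim).
Qed.
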